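(* Let $\widehat{\mathbf{f}}^{(k)}$, $\mathbf{p}^{(k)}$ $(k\ge 0)$ be generated by the preconditioned nonlinear conjugate gradient iteration with preconditioner $M$ and step sizes $\alpha_k$, applied to the normalized authalic energy $\widetilde{E}_A$ (all described in the context), where $M^{-1}$ is a symmetric positive definite matrix. Suppose $\nabla\widetilde{E}_A$ is Lipschitz continuous, and the step size $\alpha_k$ satisfies the strong Wolfe conditions with $0<c_1<c_2<\frac12$. Then $$\liminf_{k\to\infty}\|\nabla\widetilde{E}_A(\widehat{\mathbf{f}}^{(k)})\|_{M^{-1}}=0 .$$
   Context: Energy. $\mathcal{S}\subset\mathbb{R}^3$ is a simply connected open simplicial (triangulated) surface with boundary $\partial\mathcal{S}$, with $n$ vertices $v_1,\dots,v_n$, triangular faces $\mathcal{F}(\mathcal{S})$, edges $\mathcal{E}(\mathcal{S})$ and total area $|\mathcal{S}|$; $|\tau|$ is the area of a triangle $\tau$. $\mathtt{B}$ is the ordered set of the $n_{\mathtt{B}}$ indices of boundary vertices (listed consecutively along $\partial\mathcal{S}$), and $\mathtt{I}$ is the set of the $n_{\mathtt{I}}$ indices of interior vertices. A piecewise affine map $f:\mathcal{S}\to\mathbb{R}^2$ sending boundary vertices to the unit circle is represented by the vector $\widehat{\mathbf{f}}=(\mathbf{f}_{\mathtt{I}}^1,\mathbf{f}_{\mathtt{I}}^2,\boldsymbol{\theta})\in\mathbb{R}^{2n_{\mathtt{I}}+n_{\mathtt{B}}}$, where $\mathbf{f}_{\mathtt{I}}^1,\mathbf{f}_{\mathtt{I}}^2$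 are the first and second coordinates of the images of the interior vertices and the $i$th boundary vertex is sent to $(\cos\theta_i,\sin\theta_i)$, with $\boldsymbol{\theta}=(\theta_1,\dots,\theta_{n_{\mathtt{B}}})^\top$, $0=\theta_1\le\theta_2\le\cdots\le\theta_{n_{\mathtt{B}}}\le2\pi$. Let $\mathbf{f}\in\mathbb{R}^{2n}$ be the vector of all first, then all second, coordinates of the vertex images $f(v_1),\dots,f(v_n)$. The stretch energy is $E_S(f)=\frac12\mathbf{f}^\top(I_2\otimes L_S(f))\mathbf{f}$, where $[L_S(f)]_{i,j}=-\sum_{[v_i,v_j,v_k]\in\mathcal{F}(\mathcal{S})}\frac{\cot(\theta_{i,j}^k(f))\,|f([v_i,v_j,v_k])|}{2|[v_i,v_j,v_k]|}$ if $[v_i,v_j]\in\mathcal{E}(\mathcal{S})$, $[L_S(f)]_{i,i}=-\sum_{\ell\ne i}[L_S(f)]_{i,\ell}$, and $[L_S(f)]_{i,j}=0$ otherwise; here $\theta_{i,j}^k(f)$ is the angle opposite to the edge $[f(v_i),f(v_j)]$ at the point $f(v_k)$ in the image triangle. The image area is $\mathcal{A}(f)=|f(\mathcal{S})|=\frac12\sum_{i=1}^{n_{\mathtt{B}}}\sin(\theta_{i+1}-\theta_i)$ with $\theta_{n_{\mathtt{B}}+1}:=\theta_1$. The normalized authalic energy, regarded as a function of $\widehat{\mathbf{f}}$, is $$\widetilde{E}_A(\widehat{\mathbf{f}})=\frac{|\mathcal{S}|}{\mathcal{A}(f)}E_S(f)-\mathcal{A}(f),$$ and $\nabla\widetilde{E}_A$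 is its gradient with respect to $\widehat{\mathbf{f}}=(\mathbf{f}_{\mathtt{I}}^1,\mathbf{f}_{\mathtt{I}}^2,\boldsymbol{\theta})$. Iteration. Write $\mathbf{g}^{(k)}=\nabla\widetilde{E}_A(\widehat{\mathbf{f}}^{(k)})$. From an initial $\widehat{\mathbf{f}}^{(0)}$, with $\mathbf{p}^{(0)}=-M^{-1}\mathbf{g}^{(0)}$, set for $k\ge0$ $$\widehat{\mathbf{f}}^{(k+1)}=\widehat{\mathbf{f}}^{(k)}+\alpha_k\mathbf{p}^{(k)},\quad \mathbf{p}^{(k+1)}=-M^{-1}\mathbf{g}^{(k+1)}+\beta_{k+1}\mathbf{p}^{(k)},\quad \beta_{k+1}=\frac{{\mathbf{g}^{(k+1)}}^\top M^{-1}\mathbf{g}^{(k+1)}}{{\mathbf{g}^{(k)}}^\top M^{-1}\mathbf{g}^{(k)}},$$ where $\alpha_k$ is the (positive) step size. Strong Wolfe conditions (with constants $c_1,c_2$), for all $k\ge 0$: $$\widetilde{E}_A(\widehat{\mathbf{f}}^{(k)}+\alpha_k\mathbf{p}^{(k)})\le\widetilde{E}_A(\widehat{\mathbf{f}}^{(k)})+c_1\alpha_k\nabla\widetilde{E}_A(\widehat{\mathbf{f}}^{(k)})^\top\mathbf{p}^{(k)},$$ $$|\nabla\widetilde{E}_A(\widehat{\mathbf{f}}^{(k)}+\alpha_k\mathbf{p}^{(k)})^\top\mathbf{p}^{(k)}|\le c_2|\nabla\widetilde{E}_A(\widehat{\mathbf{f}}^{(k)})^\top\mathbf{p}^{(k)}|.$$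 Norm: $\|\mathbf{v}\|_{M^{-1}}=\sqrt{\mathbf{v}^\top M^{-1}\mathbf{v}}$. *)

(* Defs.v *)
(* MathComp-Analysis; the reals are an arbitrary [R : realType]. *)
From HB Require Import structures.
From mathcomp Require Import all_boot all_order all_algebra.
From mathcomp Require Import all_classical all_reals all_analysis.
Set Implicit Arguments.
Unset Strict Implicit.
Unset Printing Implicit Defensive.
Import Order.TTheory GRing.Theory Num.Theory.
Import numFieldNormedType.Exports.
Local Open Scope classical_set_scope.
Local Open Scope ring_scope.

Section EuclideanTriangles.
Context {R : realType} {d : nat}.
Implicit Types u w a b c : 'rV[R]_d.

Definition dot u w : R := (u *m w^T) 0 0.

(* The norm of the library on ['rV_d] is the sup norm. *)
Definition enorm u : R := Num.sqrt (dot u u).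

(* The angle at [c] of the triangle [a, b, c], in [0, pi]. *)
Definition angle a b c : R :=
  acos (dot (a - c) (b - c) / (enorm (a - c) * enorm (b - c))).

(* Half the square root of the Gram determinant: for d = 3 this is half the
   norm of the cross product of the edge vectors, for d = 2 half the absolute
   value of their determinant. *)
Definition tri_area a b c : R :=
  2^-1 * Num.sqrt (dot (a - c) (a - c) * dot (b - c) (b - c)
                   - dot (a - c) (b - c) ^+ 2).

End EuclideanTriangles.

Definition cot {R : realType} (t : R) : R := cos t / sin t.

Section SimplyConnected.
Context (R : realType) (T : topologicalType) (X : set T).

Definition unit_itv : set R := [set t | 0 <= t <= 1].

Definition path_in (g : R -> T) : Prop :=
  {within unit_itv, continuous g} /\ g @` unit_itv `<=` X.

Definition path_connected : Prop :=
  X !=set0 /\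
  forall x y, X x -> X y -> exists g, [/\ path_in g, g 0 = x & g 1 = y].

Definition null_homotopic (g : R -> T) : Prop :=
  exists H : R * R -> T,
    [/\ {within unit_itv `*` unit_itv, continuous H},
        H @` (unit_itv `*` unit_itv) `<=` X,
        forall t, unit_itv t -> H (0, t) = g t /\ H (1, t) = g 0 &
        forall s, unit_itv s -> H (s, 0) = g 0 /\ H (s, 1) = g 0].

Definition simply_connected : Prop :=
  path_connected /\
  forall g, path_in g -> g 0 = g 1 -> null_homotopic g.

End SimplyConnected.

(* Vertices are numbered by ['I_n]; faces are given by their vertex sets. *)
Record mesh (R : realType) (n : nat) := Mesh {
  vert : 'I_n -> 'rV[R]_3;
  faces : {set {set 'I_n}} }.

Section SimplicialSurface.
Context {R : realType} {n : nat} (S : mesh R n).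

Definition is_face (i j k : 'I_n) : bool := [set i; j; k]%SET \in faces S.

Definition edges : {set {set 'I_n}} :=
  [set e : {set 'I_n} | (#|e| == 2%N) && [exists t in faces S, e \subset t]]%SET.

Definition is_edge (i j : 'I_n) : bool := [set i; j]%SET \in edges.

Definition hull (t : {set 'I_n}) : set 'rV[R]_3 :=
  [set x | exists w : 'I_n -> R,
     [/\ forall i, 0 <= w i, forall i, i \notin t -> w i = 0,
         \sum_i w i = 1 & x = \sum_i w i *: vert S i]].

Definition carrier : set 'rV[R]_3 :=
  [set x | exists2 t, t \in faces S & hull t x].

Definition face_area (i j k : 'I_n) : R :=
  tri_area (vert S i) (vert S j) (vert S k).

(* Each face is counted once, with its vertices in increasing order. *)
Definition surface_area : R :=
  \sum_(i < n) \sum_(j < n | (i < j)%N)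
    \sum_(k < n | (j < k)%N && is_face i j k) face_area i j k.

Definition faces_of_edge (e : {set 'I_n}) : {set {set 'I_n}} :=
  [set t in faces S | e \subset t]%SET.

Definition boundary_edges : {set {set 'I_n}} :=
  [set e in edges | #|faces_of_edge e| == 1%N]%SET.

Definition boundary_vertices : {set 'I_n} :=
  [set i | [exists e in boundary_edges, i \in e]]%SET.

(* A geometric simplicial complex in R^3, pure of dimension 2.  [hull set0] is
   empty, so faces without a common vertex are disjoint. *)
Definition embedded_complex : Prop :=
  [/\ forall t, t \in faces S -> #|t| = 3%N,
      forall i j k, is_face i j k -> 0 < face_area i j k,
      forall i, exists2 t, t \in faces S & i \in t &
      forall s t, s \in faces S -> t \in faces S ->
        hull s `&` hull t = hull (s :&: t)%SET].

(* Local surface condition: since edges lie in at most two faces, the link of a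
   vertex has degrees at most 2, and being connected it is a path or a cycle. *)
Definition locally_surface : Prop :=
  (forall e, e \in edges -> (#|faces_of_edge e| <= 2)%N) /\
  (forall i j k, is_edge i j -> is_edge i k ->
     connect (fun u w => is_face i u w) j k).

(* "Open" means that the boundary is not empty. *)
Definition simply_connected_open_surface : Prop :=
  [/\ embedded_complex, locally_surface, boundary_edges != finset.set0 &
      simply_connected R carrier].

(* [bd] lists the boundary vertices in cyclic order along the boundary, [ordS]
   being the cyclic successor; [it] lists the interior vertices. *)
Definition boundary_listing (nB : nat) (bd : 'I_nB -> 'I_n) : Prop :=
  [/\ injective bd, forall j, (j \in boundary_vertices) = (j \in codom bd) &
      forall i, [set bd i; bd (ordS i)]%SET \in boundary_edges].

Definition interior_listing (nI : nat) (it : 'I_nI -> 'I_n) : Prop :=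
  injective it /\ forall j, (j \notin boundary_vertices) = (j \in codom it).

End SimplicialSurface.

Section Energy.
Context {R : realType} {n : nat} (S : mesh R n).

(* A piecewise affine map to R^2 is given by [f], all first and then all second
   coordinates of the images of the vertices. *)
Definition vertex_image (f : 'cV[R]_(n + n)) (i : 'I_n) : 'rV[R]_2 :=
  \row_(c < 2) (if c == 0 then usubmx f i 0 else dsubmx f i 0).

Definition image_area (f : 'cV[R]_(n + n)) (i j k : 'I_n) : R :=
  tri_area (vertex_image f i) (vertex_image f j) (vertex_image f k).

Definition stretch_weight (f : 'cV[R]_(n + n)) (i j : 'I_n) : R :=
  \sum_(k < n | is_face S i j k)
    cot (angle (vertex_image f i) (vertex_image f j) (vertex_image f k))
      * image_area f i j k
      / (2 * face_area S i j k).

(* If an image triangle is degenerate its cotangents are meaningless; with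
   x / 0 = 0 it contributes 0.  This is the right value for the energy below,
   which equals the sum over the faces t of |f(t)|^2 / |t|. *)
Definition stretch_laplacian (f : 'cV[R]_(n + n)) : 'M[R]_n :=
  let off i j := if (i != j) && is_edge S i j then - stretch_weight f i j else 0 in
  \matrix_(i, j) if i == j then - \sum_(l < n | l != i) off i l else off i j.

(* The block diagonal matrix is the Kronecker product of I_2 and L_S(f). *)
Definition stretch_energy (f : 'cV[R]_(n + n)) : R :=
  let L := stretch_laplacian f in
  2^-1 * (f^T *m block_mx L 0 0 L *m f) 0 0.

Context {nI nB : nat} (it : 'I_nI -> 'I_n) (bd : 'I_nB -> 'I_n).

(* The blocks of the vector of unknowns x = (f_I^1, f_I^2, theta). *)
Definition int1 (x : 'cV[R]_(nI + nI + nB)) : 'cV[R]_nI := usubmx (usubmx x).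
Definition int2 (x : 'cV[R]_(nI + nI + nB)) : 'cV[R]_nI := dsubmx (usubmx x).
Definition theta (x : 'cV[R]_(nI + nI + nB)) : 'cV[R]_nB := dsubmx x.

(* The default 0 is never used when [it] and [bd] together list all vertices. *)
Definition place (a : 'I_nI -> R) (b : 'I_nB -> R) (j : 'I_n) : R :=
  if [pick i | it i == j] is Some i then a i
  else if [pick i | bd i == j] is Some i then b i else 0.

Definition map_coords (x : 'cV[R]_(nI + nI + nB)) : 'cV[R]_(n + n) :=
  col_mx
    (\col_j place (fun i => int1 x i 0) (fun i => cos (theta x i 0)) j)
    (\col_j place (fun i => int2 x i 0) (fun i => sin (theta x i 0)) j).

Definition disk_area (x : 'cV[R]_(nI + nI + nB)) : R :=
  2^-1 * \sum_(i < nB) sin (theta x (ordS i) 0 - theta x i 0).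

Definition authalic_energy (x : 'cV[R]_(nI + nI + nB)) : R :=
  surface_area S / disk_area x * stretch_energy (map_coords x) - disk_area x.

End Energy.

(* The energy has a pole where the image area vanishes; an image area being
   positive, this open set is the domain of the energy. *)
Definition energy_domain (R : realType) (nI nB : nat) :
  set 'cV[R]_(nI + nI + nB) := [set x | 0 < disk_area x].

Section ConjugateGradient.
Context {R : realType} {N : nat}.
Implicit Types (E : 'cV[R]_N -> R) (g : 'cV[R]_N -> 'cV[R]_N) (W M : 'M[R]_N).
Implicit Types (x p : nat -> 'cV[R]_N) (alpha : nat -> R).

Definition grad E (x : 'cV[R]_N) : 'cV[R]_N := \col_i 'D_(delta_mx i 0) E x.

Definition inner (u v : 'cV[R]_N) : R := (u^T *m v) 0 0.

Definition symmetric_posdef W : Prop :=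
  W^T = W /\ forall v : 'cV[R]_N, v != 0 -> 0 < inner v (W *m v).

Definition wnorm W (v : 'cV[R]_N) : R := Num.sqrt (inner v (W *m v)).

(* [g] is the gradient field.  If some g (x k) = 0 then beta, p and the steps
   are 0 from that k on (x / 0 = 0): the iteration stops there. *)
Definition pcg_iteration g M alpha x p : Prop :=
  let W := invmx M in
  let beta k :=
    inner (g (x k.+1)) (W *m g (x k.+1)) / inner (g (x k)) (W *m g (x k)) in
  [/\ forall k, 0 < alpha k,
      p 0%N = - (W *m g (x 0%N)),
      forall k, x k.+1 = x k + alpha k *: p k &
      forall k, p k.+1 = - (W *m g (x k.+1)) + beta k *: p k].

Definition strong_wolfe E c1 c2 alpha x p : Prop :=
  forall k,
    E (x k + alpha k *: p k)
      <= E (x k) + c1 * alpha k * inner (grad E (x k)) (p k) /\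
    `|inner (grad E (x k + alpha k *: p k)) (p k)|
      <= c2 * `|inner (grad E (x k)) (p k)|.

End ConjugateGradient.

(* Main.v *)
(* Zoutendijk's argument combined with Al-Baali's descent estimate.  With
   W = M^-1, r_k = g_k^T W g_k and d_k = g_k^T p_k, the second Wolfe condition
   with c2 < 1/2 and the Fletcher-Reeves formula give by induction
   -1/(1-c2) <= d_k/r_k <= (2c2-1)/(1-c2) < 0.  The Lipschitz bound, needed only
   between consecutive iterates, and the second Wolfe condition bound alpha_k
   from below, so by the first one the energy decreases at step k by at least a
   multiple of d_k^2 / q_k, where q_k = p_k^T M p_k.  If r_k were bounded below,
   q_k / r_k^2 would grow at most linearly and the decrease would be at least a
   multiple of 1/(k+1), contradicting a lower bound on the energy.
   The energy is bounded below because the image area is at most nB/2 and the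
   stretch energy is nonnegative: in each triangle the cotangent-weighted sum of
   the squared edge lengths is four times the area. *)
Require Import Defs.
From HB Require Import structures.
From mathcomp Require Import all_boot all_order all_algebra.
From mathcomp Require Import all_classical all_reals all_analysis.
From mathcomp Require Import ring lra.
Set Implicit Arguments.
Unset Strict Implicit.
Unset Printing Implicit Defensive.
Import Order.TTheory GRing.Theory Num.Theory.
Import numFieldNormedType.Exports.
Local Open Scope classical_set_scope.
Local Open Scope ring_scope.

(** * Nonnegativity of the stretch energy *)

Section Dot.
Context {R : realType} {d : nat}.
Implicit Types u v w : 'rV[R]_d.

Lemma dotE u v : dot u v = \sum_i u 0 i * v 0 i.
Proof. by rewrite /dot mxE; apply: eq_bigr => i _; rewrite mxE. Qed.

Lemma dotC u v : dot u v = dot v u.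
Proof. by rewrite !dotE; apply: eq_bigr => i _; rewrite mulrC. Qed.

Lemma dotBl u v w : dot (u - v) w = dot u w - dot v w.
Proof. by rewrite /dot mulmxBl !mxE. Qed.

Lemma dotBr u v w : dot u (v - w) = dot u v - dot u w.
Proof. by rewrite dotC dotBl !(dotC u). Qed.

Lemma dotZl a u v : dot (a *: u) v = a * dot u v.
Proof. by rewrite /dot -scalemxAl mxE. Qed.

Lemma dotZr a u v : dot u (a *: v) = a * dot u v.
Proof. by rewrite dotC dotZl dotC. Qed.

Lemma dot_ge0 u : 0 <= dot u u.
Proof. by rewrite dotE sumr_ge0// => i _; rewrite -expr2 sqr_ge0. Qed.

Lemma dot_eq0 u : (dot u u == 0) = (u == 0).
Proof.
apply/eqP/eqP => [|->]; last by rewrite /dot mul0mx mxE.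
rewrite dotE => /eqP; rewrite psumr_eq0; last first.
  by move=> i _; rewrite -expr2 sqr_ge0.
move=> /allP h; apply/rowP => i; rewrite mxE.
have := h i (mem_index_enum _); rewrite -expr2 sqrf_eq0 => /eqP; exact.
Qed.

Definition gram u v : R := dot u u * dot v v - dot u v ^+ 2.

(** This is Cauchy-Schwarz: the squared length of [dot v v *: u - dot u v *: v] is
    [dot v v * gram u v]. *)
Lemma gram_ge0 u v : 0 <= gram u v.
Proof.
have [->|v0] := eqVneq v 0.
  by rewrite /gram /dot trmx0 !mulmx0 !mxE mulr0 expr0n subr0.
have dv : 0 < dot v v by rewrite lt_def dot_eq0 v0 dot_ge0.
have := dot_ge0 (dot v v *: u - dot u v *: v).
rewrite dotBl !dotBr !dotZl !dotZr (dotC v u) => h.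
by rewrite -(pmulr_rge0 _ dv) /gram; nra.
Qed.

End Dot.

(** * Cotangents and area of a single triangle *)

Section Triangle.
Context {R : realType} {d : nat}.
Implicit Types a b c : 'rV[R]_d.

Lemma tri_areaE a b c : tri_area a b c = 2^-1 * Num.sqrt (gram (a - c) (b - c)).
Proof. by []. Qed.

Lemma tri_area_ge0 a b c : 0 <= tri_area a b c.
Proof. by rewrite mulr_ge0 ?invr_ge0 ?sqrtr_ge0. Qed.

Lemma tri_area_swap a b c : tri_area a b c = tri_area b a c.
Proof.
rewrite !tri_areaE; congr (_ * Num.sqrt _).
by rewrite /gram (dotC (b - c) (a - c)); ring.
Qed.

Lemma tri_area_rot a b c : tri_area a b c = tri_area b c a.
Proof.
rewrite !tri_areaE; congr (_ * Num.sqrt _).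
by rewrite /gram !dotBl !dotBr (dotC b a) (dotC c a) (dotC c b); ring.
Qed.

(** The cotangent is the dot product divided by the square root of the Gram determinant, and the
    area is half that root, so the root cancels. The indicator covers degenerate triangles, where
    the dot product may be nonzero while the left side vanishes. *)
Lemma cot_angle_area a b c :
  cot (angle a b c) * tri_area a b c =
  (tri_area a b c != 0)%:R * dot (a - c) (b - c) / 2.
Proof.
have [->|A0] := eqVneq (tri_area a b c) 0; first by rewrite mulr0 !mul0r.
rewrite mul1r; move: A0; rewrite tri_areaE.
rewrite mulf_eq0 invr_eq0 pnatr_eq0/= sqrtr_eq0 -ltNge => g0.
rewrite /angle; set u := a - c in g0 *; set v := b - c in g0 *.
have uv : 0 < dot u u * dot v v.
  by apply: lt_le_trans g0 _; rewrite /gram lerBlDr lerDl sqr_ge0.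
have nE : enorm u * enorm v = Num.sqrt (dot u u * dot v v).
  by rewrite sqrtrM ?dot_ge0.
have n0 : 0 < enorm u * enorm v by rewrite nE sqrtr_gt0.
have n2 : (enorm u * enorm v) ^+ 2 = dot u u * dot v v.
  by rewrite nE sqr_sqrtr// ltW.
move: n0 n2; set m := enorm u * enorm v => n0 n2.
have cs : -1 <= dot u v / m <= 1.
  rewrite -ler_norml -(@ler_sqr _ _ 1) ?nnegrE// expr1n -normrX ger0_norm ?sqr_ge0//.
  by rewrite expr_div_n n2 ler_pdivrMr// mul1r -subr_ge0; apply: gram_ge0.
rewrite /cot sin_acos// acosK ?in_itv//.
have -> : 1 - (dot u v / m) ^+ 2 = gram u v / m ^+ 2.
  by rewrite /gram -n2; field; rewrite gt_eqF.
rewrite sqrtrM ?(ltW g0)// -exprVn sqrtr_sqr ger0_norm ?invr_ge0 ?(ltW n0)//.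
by field; rewrite !gt_eqF// sqrtr_gt0.
Qed.

(** The three corners share one area. If it is zero, every term vanishes; otherwise the sum is the
    Gram determinant, that is, four times the squared area. *)
Lemma cot_angle_area_edges_ge0 a b c :
  0 <= cot (angle a b c) * tri_area a b c * dot (a - b) (a - b)
     + cot (angle b c a) * tri_area b c a * dot (b - c) (b - c)
     + cot (angle c a b) * tri_area c a b * dot (c - a) (c - a).
Proof.
rewrite !cot_angle_area (tri_area_rot b c a) -!(tri_area_rot c a b).
have [_|_] := eqVneq (tri_area c a b) 0; first by rewrite !mul0r !addr0.
rewrite !mul1r; suff -> : dot (a - c) (b - c) / 2 * dot (a - b) (a - b)
     + dot (b - a) (c - a) / 2 * dot (b - c) (b - c)
     + dot (c - b) (a - b) / 2 * dot (c - a) (c - a) = gram (a - c) (b - c).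
  exact: gram_ge0.
rewrite /gram !dotBl !dotBr (dotC b a) (dotC c a) (dotC c b).
by field.
Qed.

End Triangle.

(** Zero row sums turn the form into the sum of [h i 0 * (w i j * (h i 0 - h j 0))]; adding the copy
    with [i] and [j] exchanged produces the squares. *)
Lemma laplacian_formE (R : realFieldType) n (w : 'I_n -> 'I_n -> R)
    (L : 'M[R]_n) (h : 'cV[R]_n) :
  (forall i j, w i j = w j i) ->
  (forall i j, i != j -> L i j = - w i j) ->
  (forall i, L i i = \sum_(l < n | l != i) w i l) ->
  2 * (h^T *m L *m h) 0 0 = \sum_i \sum_j w i j * (h i 0 - h j 0) ^+ 2.
Proof.
move=> wC Loff Ldiag.
have -> : (h^T *m L *m h) 0 0 =
    \sum_i \sum_j h i 0 * (w i j * (h i 0 - h j 0)).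
  rewrite -mulmxA mxE; apply: eq_bigr => i _; rewrite !mxE -mulr_sumr; congr (_ * _).
  rewrite (bigD1 i)//= Ldiag [RHS](bigD1 i)//= subrr mulr0 add0r.
  rewrite mulr_suml -big_split/=; apply: eq_bigr => j ji.
  by rewrite Loff 1?eq_sym//; ring.
rewrite mulr2n mulrDl mul1r {2}exchange_big/= -big_split/=.
apply: eq_bigr => i _; rewrite -big_split/=; apply: eq_bigr => j _.
by rewrite (wC j i); ring.
Qed.

(** Single cotangent terms can be negative, so only sums over rotations are assumed nonnegative;
    three times the total is a sum of these. *)
Lemma sum3_rot_ge0 (R : realFieldType) n (T : 'I_n -> 'I_n -> 'I_n -> R) :
  (forall i j k, 0 <= T i j k + T j k i + T k i j) ->
  0 <= \sum_i \sum_j \sum_k T i j k.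
Proof.
move=> T0; set s := (X in 0 <= X).
have E1 : \sum_i \sum_j \sum_k T j k i = s.
  rewrite exchange_big/= /s; apply: eq_bigr => j _.
  by rewrite exchange_big.
have E2 : \sum_i \sum_j \sum_k T k i j = s.
  rewrite /s [RHS]exchange_big/=; apply: eq_bigr => i _.
  by rewrite exchange_big.
suff : 0 <= s + s + s by rewrite -mulr2n -mulrSr pmulrn_lge0.
rewrite -{2}E1 -{2}E2 /s -!big_split/=; apply: sumr_ge0 => i _.
rewrite -!big_split/=; apply: sumr_ge0 => j _.
by rewrite -!big_split/=; apply: sumr_ge0 => k _.
Qed.

(** * Lower bound for the normalized authalic energy *)

Section Energy.
Context {R : realType} {n : nat} (S : mesh R n).
Implicit Types (f : 'cV[R]_(n + n)) (i j k : 'I_n).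

Lemma is_face_swap i j k : is_face S i j k = is_face S j i k.
Proof. by rewrite /is_face (finset.setUC [set i]%SET). Qed.

Lemma is_face_rot i j k : is_face S i j k = is_face S j k i.
Proof. by rewrite /is_face -finset.setUA finset.setUC. Qed.

Lemma is_face_edge i j k : is_face S i j k -> i != j -> is_edge S i j.
Proof.
move=> fijk ij; rewrite /is_edge inE cards2 ij/=.
apply/existsP; exists [set i; j; k]%SET.
by rewrite -/(is_face S i j k) fijk finset.subsetUl.
Qed.

Lemma vertex_image_distE f i j :
  let v := vertex_image f in
  dot (v i - v j) (v i - v j) = (usubmx f i 0 - usubmx f j 0) ^+ 2
                              + (dsubmx f i 0 - dsubmx f j 0) ^+ 2.
Proof. by rewrite /= dotE !big_ord_recl big_ord0 !mxE/= addr0. Qed.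

Lemma stretch_weight_sym f i j : stretch_weight S f i j = stretch_weight S f j i.
Proof.
rewrite /stretch_weight; apply: eq_big => [k|k _]; first exact: is_face_swap.
rewrite /image_area /face_area (tri_area_swap (vert S i)) !cot_angle_area.
by rewrite (tri_area_swap (vertex_image f i)) dotC.
Qed.

Lemma stretch_energy_ge0 f : 0 <= stretch_energy S f.
Proof.
rewrite /stretch_energy; set L := stretch_laplacian S f.
rewrite mulr_ge0 ?invr_ge0// -[f]vsubmxK.
rewrite tr_col_mx mul_row_block !mulmx0 addr0 add0r mul_row_col mxE.
set f1 := usubmx f; set f2 := dsubmx f.
pose w i j := if (i != j) && is_edge S i j then stretch_weight S f i j else 0.
have wC i j : w i j = w j i.
  by rewrite /w eq_sym /is_edge finset.setUC stretch_weight_sym.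
have Loff i j : i != j -> L i j = - w i j.
  move=> ij; rewrite mxE (negbTE ij) /w ij/=.
  by case: ifP => //; rewrite oppr0.
have Ldiag i : L i i = \sum_(l < n | l != i) w i l.
  rewrite mxE eqxx -sumrN; apply: eq_bigr => l _.
  by rewrite /w; case: ifP => //; rewrite ?oppr0 ?opprK.
have := laplacian_formE f1 wC Loff Ldiag.
have := laplacian_formE f2 wC Loff Ldiag.
rewrite -(pmulr_rge0 _ (ltr0n R 2)) mulrDr => -> ->.
pose v := vertex_image f.
(* [T i j k] is what the corner [k] of a face contributes to the energy of the edge [i], [j]; the
   three rotations of a face have the same coefficient in front. *)
pose T i j k := (is_face S i j k)%:R / (2 * face_area S i j k) *
  (cot (angle (v i) (v j) (v k)) * tri_area (v i) (v j) (v k) *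
   dot (v i - v j) (v i - v j)).
suff <- : \sum_i \sum_j \sum_k T i j k =
    \sum_i \sum_j w i j * (f1 i 0 - f1 j 0) ^+ 2
  + \sum_i \sum_j w i j * (f2 i 0 - f2 j 0) ^+ 2.
  apply: sum3_rot_ge0 => i j k; rewrite /T.
  rewrite -(is_face_rot i j k) -(is_face_rot k i j) /face_area.
  rewrite -(tri_area_rot (vert S i)) -(tri_area_rot (vert S k)) -!mulrDr.
  rewrite mulr_ge0 ?cot_angle_area_edges_ge0//.
  by rewrite mulr_ge0 ?invr_ge0 ?mulr_ge0 ?tri_area_ge0.
rewrite -big_split/=; apply: eq_bigr => i _.
rewrite -big_split/=; apply: eq_bigr => j _.
rewrite -mulrDr -vertex_image_distE -/v.
have [->|ij] := eqVneq i j.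
  rewrite /T subrr /dot mul0mx mxE mulr0.
  by rewrite big1// => k _; rewrite !mulr0.
(* If the two vertices span no edge, no face contains both, and the weight is an empty sum. *)
have -> : w i j = stretch_weight S f i j.
  rewrite /w ij/=; case: ifPn => // ne; rewrite /stretch_weight big1// => k fk.
  by rewrite (is_face_edge fk ij) in ne.
rewrite /stretch_weight mulr_suml [RHS]big_mkcond/=; apply: eq_bigr => k _.
rewrite /T; case: ifP => _; last by rewrite !mul0r.
by rewrite mul1r /image_area; ring.
Qed.

Lemma surface_area_ge0 : 0 <= surface_area S.
Proof. by do 3![apply: sumr_ge0 => ? _]; exact: tri_area_ge0. Qed.

Lemma disk_area_le nI nB (x : 'cV[R]_(nI + nI + nB)) : disk_area x <= 2^-1 * nB%:R.
Proof.
rewrite ler_wpM2l ?invr_ge0// -[in leRHS](card_ord nB) -sum1_card natr_sum.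
by apply: ler_sum => i _; exact: sin_le1.
Qed.

Lemma authalic_energy_ge nI nB (it : 'I_nI -> 'I_n) (bd : 'I_nB -> 'I_n) x :
  0 < disk_area x -> - (2^-1 * nB%:R) <= authalic_energy S it bd x.
Proof.
move=> A0; rewrite /authalic_energy -[leLHS]add0r lerD ?lerN2 ?disk_area_le//.
by rewrite mulr_ge0 ?stretch_energy_ge0// divr_ge0 ?surface_area_ge0// ltW.
Qed.

End Energy.

(** * Fletcher-Reeves iterations *)

Lemma harmonic_series_unbounded (R : realType) (B : R) :
  exists n, B < series harmonic n.
Proof.
apply: contrapT => /forallNP H; apply: (@dvg_harmonic R).
apply: nondecreasing_is_cvgn.
  apply/nondecreasing_seqP => n.
  by rewrite /series/= big_nat_recr//= lerDl invr_ge0.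
exists B => _ [n _ <-]; rewrite leNgt; exact/negP.
Qed.

(* Here and below r, d and s stand for g_k^T W g_k, g_k^T p_k and
   g_(k+1)^T p_k, and later q for p_k^T M p_k. *)
Lemma fletcher_reeves_descent (R : realFieldType) (c2 : R) (r d s : nat -> R) :
  0 < c2 -> c2 < 2^-1 -> (forall k, 0 < r k) ->
  d 0%N = - r 0%N -> (forall k, d k.+1 = - r k.+1 + r k.+1 / r k * s k) ->
  (forall k, `|s k| <= c2 * `|d k|) ->
  forall k, - r k <= (1 - c2) * d k <= (2 * c2 - 1) * r k.
Proof.
move=> c20 c2h r0 d0 dS hs; elim=> [|k /andP[lo up]].
  by have := r0 0%N; rewrite d0; nra.
have dneg : d k < 0 by have := r0 k; nra.
have := hs k; rewrite (ltr0_norm dneg) ler_norml => /andP[slo sup].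
have rk := r0 k; have rk1 := r0 k.+1.
(* With [y] the recurrence reads d_(k+1) = r_(k+1) (y - 1), and the Wolfe condition with the lower
   bound on d_k gives |y| <= c2 / (1 - c2). *)
rewrite dS; set y := s k / r k.
have -> : r k.+1 / r k * s k = r k.+1 * y by rewrite /y; field; rewrite gt_eqF.
have sE : s k = y * r k by rewrite /y divfK// gt_eqF.
rewrite {}sE in slo sup.
have ylo : - c2 <= (1 - c2) * y.
  by rewrite -(ler_pM2r rk); nra.
have yup : (1 - c2) * y <= c2.
  by rewrite -(ler_pM2r rk); nra.
by nra.
Qed.

(** The vectors enter only through scalar sequences: the recurrence for [q] expands the square of
    the new direction in the form of M, and [L] already includes the comparison between that form
    and the norm. *)
Lemma fletcher_reeves_no_gap (R : realType) (c1 c2 L e B : R)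
    (E r d s q alpha : nat -> R) :
  0 < c1 -> 0 < c2 -> c2 < 2^-1 -> 0 < L -> 0 < e ->
  (forall k, B <= E k) -> (forall k, e <= r k) ->
  d 0%N = - r 0%N -> (forall k, d k.+1 = - r k.+1 + r k.+1 / r k * s k) ->
  q 0%N = r 0%N ->
  (forall k, q k.+1 =
     r k.+1 - 2 * (r k.+1 / r k) * s k + (r k.+1 / r k) ^+ 2 * q k) ->
  (forall k, 0 < alpha k) ->
  (forall k, `|s k| <= c2 * `|d k|) ->
  (forall k, s k - d k <= L * alpha k * q k) ->
  (forall k, E k.+1 <= E k + c1 * alpha k * d k) ->
  False.
Proof.
move=> c10 c20 c2h L0 e0 BE er d0 dS q0 qS a0 hs hL hE.
have r0 k : 0 < r k by exact: lt_le_trans (er k).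
have hd := fletcher_reeves_descent c20 c2h r0 d0 dS hs.
have dup k : (1 - 2 * c2) * r k <= - d k.
  by case/andP: (hd k) => lo up; have := r0 k; nra.
have dneg k : d k < 0 by have := dup k; have := r0 k; nra.
(* Divided by r_(k+1)^2, the recurrence raises q / r^2 by at most 3 / e per step: c2 < 1/2 gives -y
   <= 1, so the first two terms are at most 3 r_(k+1), and r_(k+1) >= e. *)
have hq k : q k <= 3 * k.+1%:R / e * r k ^+ 2.
  elim: k => [|k IH].
    rewrite q0 mulr1 expr2 mulrA -{1}[r 0%N]mul1r ler_pM2r//.
    by rewrite mulrAC ler_pdivlMr//; have := er 0%N; nra.
  have rk := r0 k; have rk1 := r0 k.+1.
  rewrite qS; set y := s k / r k.
  have -> : 2 * (r k.+1 / r k) * s k = 2 * r k.+1 * y.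
    by rewrite /y; field; rewrite gt_eqF.
  have ylo : - y <= 1.
    have := hs k; rewrite (ltr0_norm (dneg k)) ler_norml => /andP[slo _].
    rewrite -(ler_pM2r rk) mulNr /y divfK ?gt_eqF// mul1r.
    by case/andP: (hd k) => lo up; nra.
  have h1 : (r k.+1 / r k) ^+ 2 * q k <= 3 * k.+1%:R / e * r k.+1 ^+ 2.
    apply: (@le_trans _ _ ((r k.+1 / r k) ^+ 2 * (3 * k.+1%:R / e * r k ^+ 2))).
      by rewrite ler_wpM2l// sqr_ge0.
    by rewrite le_eqVlt; apply/orP; left; apply/eqP; field; rewrite !gt_eqF.
  have h2 : r k.+1 - 2 * r k.+1 * y <= 3 / e * r k.+1 ^+ 2.
    apply: (@le_trans _ _ (3 * r k.+1)); first by nra.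
    rewrite expr2 mulrA ler_pM2r// mulrAC ler_pdivlMr//.
    by have := er k.+1; nra.
  apply: le_trans (lerD h2 h1) _.
  rewrite -[in leRHS]natr1 le_eqVlt; apply/orP; left; apply/eqP.
  by field; rewrite gt_eqF.
(* The constant comes from alpha_k (-d_k) >= (1 - c2) d_k^2 / (L q_k), with -d_k >= (1 - 2 c2) r_k
   and the linear bound on q_k / r_k^2. *)
pose c := e * (1 - c2) * (1 - 2 * c2) ^+ 2 / (3 * L).
have cgt0 : 0 < c.
  by rewrite /c divr_gt0 ?mulr_gt0// ?exprn_gt0//; lra.
have dec k : E k.+1 <= E k - c1 * (c / k.+1%:R).
  apply: le_trans (hE k) _; rewrite lerD2l.
  (* The second Wolfe condition gives s_k >= c2 d_k, so the slope along the step rises by at least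
     (1 - c2) (-d_k). *)
  have curv : (1 - c2) * (- d k) <= L * alpha k * q k.
    apply: le_trans (hL k).
    have := hs k; rewrite (ltr0_norm (dneg k)) ler_norml => /andP[slo _].
    by lra.
  set m : R := k.+1%:R in hq *.
  have m0 : 0 < m by rewrite ltr0n.
  have rk := r0 k; have dk := dneg k; have ak := a0 k.
  have key : (1 - c2) * (1 - 2 * c2) ^+ 2 <= L * (alpha k * - d k) * (3 * m / e).
    have rk2 : 0 < r k ^+ 2 by rewrite exprn_gt0.
    rewrite -(ler_pM2r rk2).
    apply: (@le_trans _ _ ((1 - c2) * (- d k) * (- d k))).
      have := dup k; set z := _ * r k => hz.
      have z0 : 0 <= z by rewrite /z mulr_ge0//; [lra|exact: ltW].
      have -> : (1 - c2) * (1 - 2 * c2) ^+ 2 * r k ^+ 2 = (1 - c2) * (z * z).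
        by rewrite /z; ring.
      by rewrite -mulrA ler_pM2l ?ler_pM//; lra.
    apply: (@le_trans _ _ (L * alpha k * q k * (- d k))).
      by rewrite ler_pM2r//; lra.
    have -> : L * (alpha k * - d k) * (3 * m / e) * r k ^+ 2 =
      L * alpha k * (3 * m / e * r k ^+ 2) * (- d k) by ring.
    rewrite ler_pM2r; last lra.
    by rewrite ler_pM2l ?mulr_gt0//; exact: hq.
  rewrite -mulrA -mulrN ler_pM2l// lerNr -mulrN.
  rewrite ler_pdivrMr// /c ler_pdivrMr; last by rewrite mulr_gt0.
  have -> : (e * (1 - c2) * (1 - 2 * c2) ^+ 2) =
    (1 - c2) * (1 - 2 * c2) ^+ 2 * e by ring.
  rewrite -ler_pdivlMr//; apply: le_trans key _.
  by rewrite le_eqVlt; apply/orP; left; apply/eqP; ring.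
have sumE k : E k <= E 0%N - c1 * (c * series harmonic k).
  elim: k => [|k IH]; first by rewrite /series/= big_geq// !mulr0 subr0.
  apply: le_trans (dec k) _.
  rewrite /series/= big_nat_recr//= -[\sum_(0 <= i < k) _]/(series harmonic k).
  by rewrite !mulrDr opprD addrA lerD2r.
have [k hk] := harmonic_series_unbounded ((E 0%N - B) / (c1 * c)).
have c1c : 0 < c1 * c by rewrite mulr_gt0.
have : E 0%N - B < c1 * (c * series harmonic k).
  by rewrite mulrA mulrC -ltr_pdivrMr.
by have := sumE k; have := BE k; lra.
Qed.

(** * The quadratic form of W and its comparison with the sup norm *)

Section Inner.
Context {R : realType} {N : nat}.
Implicit Types (u v w : 'cV[R]_N) (W : 'M[R]_N).

Lemma innerE u v : inner u v = \sum_i u i 0 * v i 0.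
Proof. by rewrite /inner mxE; apply: eq_bigr => i _; rewrite mxE. Qed.

Lemma innerC u v : inner u v = inner v u.
Proof. by rewrite !innerE; apply: eq_bigr => i _; rewrite mulrC. Qed.

Lemma innerDr u v w : inner u (v + w) = inner u v + inner u w.
Proof. by rewrite /inner mulmxDr mxE. Qed.

Lemma innerZr a u v : inner u (a *: v) = a * inner u v.
Proof. by rewrite /inner -scalemxAr mxE. Qed.

Lemma innerNr u v : inner u (- v) = - inner u v.
Proof. by rewrite -scaleN1r innerZr mulN1r. Qed.

Lemma innerDl u v w : inner (u + v) w = inner u w + inner v w.
Proof. by rewrite innerC innerDr !(innerC w). Qed.

Lemma innerZl a u v : inner (a *: u) v = a * inner u v.
Proof. by rewrite innerC innerZr innerC. Qed.

Lemma innerNl u v : inner (- u) v = - inner u v.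
Proof. by rewrite innerC innerNr innerC. Qed.

Lemma inner_mulmxC W u v : W^T = W -> inner u (W *m v) = inner v (W *m u).
Proof. by move=> WT; rewrite innerC /inner trmx_mul WT mulmxA. Qed.

Lemma posdef_ge0 W u : symmetric_posdef W -> 0 <= inner u (W *m u).
Proof.
move=> [_ Wpos]; have [->|/Wpos/ltW//] := eqVneq u 0.
by rewrite mulmx0 /inner mulmx0 mxE.
Qed.

Lemma posdef_CauchySchwarz W u v : symmetric_posdef W ->
  inner u (W *m v) ^+ 2 <= inner u (W *m u) * inner v (W *m v).
Proof.
move=> PW; have [WT Wpos] := PW.
have [->|v0] := eqVneq v 0.
  by rewrite mulmx0 /inner !mulmx0 !mxE mulr0 expr0n.
have vv := Wpos _ v0.
set a := inner v (W *m v) in vv *; set b := inner u (W *m v).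
have := posdef_ge0 (a *: u - b *: v) PW.
rewrite mulmxBr -!scalemxAr innerDr innerNr !innerZr !innerDl !innerNl !innerZl.
rewrite (inner_mulmxC v u WT) -/a -/b => h.
by rewrite -subr_ge0 -(pmulr_rge0 _ vv); nra.
Qed.

Lemma entry_le_mx_norm u i : `|u i 0| <= `|u|.
Proof.
by rewrite [leRHS]mx_normrE (le_bigmax 0 (fun ij => `|u ij.1 ij.2|) (i, 0)).
Qed.

(** The dimension appears as a factor because the norm is the sup norm. *)
Lemma inner_le_mx_norm u v : inner u v <= N%:R * (`|u| * `|v|).
Proof.
rewrite innerE mulr_natl -[X in _ *+ X](card_ord N) -sumr_const.
apply: ler_sum => i _; apply: le_trans (ler_norm _) _.
by rewrite normrM ler_pM// entry_le_mx_norm.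
Qed.

(** An entry of [W *m z] is the W-product of a basis vector with [z], so Cauchy-Schwarz bounds its
    square by a diagonal entry of [W] times the form at [z]. Thus one plus the trace serves as [C];
    the one keeps it positive even in dimension 0. *)
Lemma mx_norm_posdef_le W : symmetric_posdef W ->
  exists2 C : R, 0 < C & forall z, `|W *m z| ^+ 2 <= C * inner z (W *m z).
Proof.
move=> PW; pose e i : 'cV[R]_N := delta_mx i 0.
have entryE i v : v i 0 = inner (e i) v.
  rewrite innerE (bigD1 i)//= mxE !eqxx mul1r big1 ?addr0// => j ji.
  by rewrite mxE (negbTE ji) mul0r.
exists (1 + \sum_i inner (e i) (W *m e i)).
  by rewrite ltr_wpDr// sumr_ge0// => i _; exact: posdef_ge0.
move=> z; set C := (X in X * _); have q0 := posdef_ge0 z PW.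
have C0 : 0 <= C by rewrite addr_ge0// sumr_ge0// => i _; exact: posdef_ge0.
rewrite -[leRHS]sqr_sqrtr ?mulr_ge0//.
rewrite ler_sqr ?nnegrE ?sqrtr_ge0//.
rewrite [leLHS]mx_normrE; apply/bigmax_leP; split=> [|[i j] _ /=].
  exact: sqrtr_ge0.
rewrite ord1 entryE -sqrtr_sqr ler_sqrt ?mulr_ge0//.
apply: le_trans (posdef_CauchySchwarz _ _ PW) _; rewrite ler_wpM2r//.
rewrite /C (bigD1 i)//= addrCA lerDl addr_ge0// sumr_ge0// => k _.
exact: posdef_ge0.
Qed.

End Inner.

(** * From the vector iteration to the scalar recurrences *)

Section PCG.
Context {R : realType} {N : nat}.
Variables (E : 'cV[R]_N -> R) (M : 'M[R]_N) (x p : nat -> 'cV[R]_N).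
Variables (alpha : nat -> R).
Local Notation W := (invmx M).
Local Notation g k := (grad E (x k)).
Local Notation r k := (inner (g k) (W *m g k)).
Hypotheses (Munit : M \in unitmx) (PW : symmetric_posdef W).
Hypothesis iter : pcg_iteration (grad E) M alpha x p.

(** A zero gradient kills both the preconditioned term and the numerator of beta, hence the
    direction, and the iterate no longer moves. *)
Lemma pcg_stationary k : g k = 0 -> forall j, (k <= j)%N -> g j = 0.
Proof.
have [_ p0 xS pS] := iter => gk0.
have p_next j : g j = 0 -> p j = 0.
  case: j => [|j] gj; first by rewrite p0 gj mulmx0 oppr0.
  by rewrite pS gj mulmx0 oppr0 add0r /inner mulmx0 mxE mul0r scale0r.
elim=> [|j IH]; first by move: gk0 => /[swap]; rewrite leqn0 => /eqP ->.
rewrite leq_eqVlt => /predU1P[<-//|/IH gj].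
by rewrite xS p_next// scaler0 addr0.
Qed.

Variables c1 c2 L B : R.
Hypotheses (c1_gt0 : 0 < c1) (c1_lt_c2 : c1 < c2) (c2_lt : c2 < 2^-1).
Hypothesis wolfe : strong_wolfe E c1 c2 alpha x p.
Hypothesis lip : forall k, `|g k.+1 - g k| <= L * `|x k.+1 - x k|.
Hypothesis E_ge : forall k, B <= E (x k).

Lemma pcg_gradient_small (e : R) (m : nat) : 0 < e ->
  exists2 k, (m <= k)%N & r k < e.
Proof.
move=> e0; apply: contrapT => /forall2NP gap.
have [a0 p0 xS pS] := iter.
have egap k : (m <= k)%N -> e <= r k.
  by move=> mk; case: (gap k) => // /negP; rewrite leNgt.
(* A gradient vanishing at any index would still vanish beyond [m], against the gap. *)
have r0 k : 0 < r k.
  have [gk0|] := eqVneq (g k) 0; last exact: PW.2.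
  have := egap (maxn m k) (leq_maxl _ _).
  by rewrite (pcg_stationary gk0) ?leq_maxr// mulmx0 /inner mulmx0 mxE leNgt e0.
(* The scalar recurrences start at index 0, so the finitely many values before [m] are included in
   the minimum. *)
have [e' e'0 er] : exists2 e', 0 < e' & forall k, e' <= r k.
  exists (\big[Num.min/e]_(k < m) r k).
    by apply/bigmin_gtP; split.
  move=> k; have [mk|km] := leqP m k.
    by apply: le_trans (egap k mk); exact: bigmin_le_id.
  exact: (bigmin_le _ (Ordinal km) (fun i => r i)).
have [C C0 hC] := mx_norm_posdef_le PW.
(* With p = W z, the quantity p^T M p becomes z^T W z, so that only the form of [W] is used. *)
pose z k := M *m p k.
have pz k : p k = W *m z k by rewrite /z mulKmx.
(* [N] comes from the inner product bound, [C] from the norm comparison; the absolute value and the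
   added 1 make the constant positive. *)
have L0 : 0 < N%:R * `|L| * C + 1.
  by rewrite ltr_wpDl// !mulr_ge0// ltW.
have c20 : 0 < c2 by exact: lt_trans c1_lt_c2.
apply: (@fletcher_reeves_no_gap R c1 c2 (N%:R * `|L| * C + 1) e' B
  (fun k => E (x k)) (fun k => r k) (fun k => inner (g k) (p k))
  (fun k => inner (g k.+1) (p k)) (fun k => inner (z k) (W *m z k)) alpha) => //.
- by rewrite p0 innerNr.
- by move=> k; rewrite pS innerDr innerNr innerZr.
- by rewrite /z p0 mulmxN mulKVmx// mulmxN innerNr innerNl opprK.
- move=> k; set b := r k.+1 / r k.
  have -> : z k.+1 = - g k.+1 + b *: z k.
    by rewrite /z pS mulmxDr mulmxN mulKVmx// -scalemxAr.
  rewrite mulmxDr mulmxN -scalemxAr innerDr innerNr innerZr !innerDl !innerNl.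
  rewrite !innerZl (inner_mulmxC (z k) (g k.+1) PW.1) -pz.
  by ring.
- by move=> k; rewrite xS; exact: (wolfe k).2.
- move=> k /=; rewrite -[X in _ - X <= _]innerC (innerC (g k.+1)) -innerNr -innerDr.
  apply: le_trans (inner_le_mx_norm _ _) _.
  have hp : `|p k| ^+ 2 <= C * inner (z k) (W *m z k) by rewrite pz; exact: hC.
  have ak := a0 k.
  have hl : `|g k.+1 - g k| <= `|L| * (alpha k * `|p k|).
    apply: le_trans (lip k) _; rewrite xS [x k + _]addrC addrK normrZ gtr0_norm//.
    by rewrite ler_wpM2r ?ler_norm// mulr_ge0// ltW.
  apply: (@le_trans _ _ (N%:R * (`|p k| * (`|L| * (alpha k * `|p k|))))).
    by rewrite !ler_wpM2l.
  have -> : N%:R * (`|p k| * (`|L| * (alpha k * `|p k|))) =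
    N%:R * `|L| * alpha k * `|p k| ^+ 2 by ring.
  apply: (@le_trans _ _ (N%:R * `|L| * alpha k * (C * inner (z k) (W *m z k)))).
    by rewrite ler_wpM2l// !mulr_ge0// ltW.
  have -> : (N%:R * `|L| * C + 1) * alpha k * inner (z k) (W *m z k) =
     N%:R * `|L| * alpha k * (C * inner (z k) (W *m z k))
     + alpha k * inner (z k) (W *m z k) by ring.
  by rewrite lerDl mulr_ge0 ?posdef_ge0// ltW.
- by move=> k; rewrite xS; exact: (wolfe k).1.
Qed.

End PCG.

(** Every tail has infimum 0, so the lower limit is that of a constant sequence. *)
Lemma limn_einf_eq0 (R : realType) (u : nat -> R) :
  (forall k, 0 <= u k) ->
  (forall e m, 0 < e -> exists2 k, (m <= k)%N & u k < e) ->
  limn_einf (fun k => (u k)%:E) = 0%E.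
Proof.
move=> u0 small; rewrite limn_einf_lim.
rewrite (_ : einfs _ = cst 0%E) ?lim_cst//; apply/funext => m /=.
apply/eqP; rewrite eq_le; apply/andP; split; last first.
  by apply: le_ereal_inf_tmp => _ [k _ <-]; rewrite lee_fin.
apply/lee_addgt0Pr => e e0; rewrite add0e.
have [k mk uk] := small e m e0.
apply: (@le_trans _ _ (u k)%:E); last by rewrite lee_fin ltW.
by apply: ereal_inf_lbound; exists k.
Qed.

Theorem theorem2 (R : realType) (n nI nB : nat) (S : mesh R n)
  (it : 'I_nI -> 'I_n) (bd : 'I_nB -> 'I_n)
  (M : 'M[R]_(nI + nI + nB))
  (D : set 'cV[R]_(nI + nI + nB))
  (x p : nat -> 'cV[R]_(nI + nI + nB)) (alpha : nat -> R) (c1 c2 : R) :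
  simply_connected_open_surface S ->
  boundary_listing S bd ->
  interior_listing S it ->
  M \in unitmx ->
  symmetric_posdef (invmx M) ->
  D `<=` @energy_domain R nI nB ->
  (forall k, D (x k)) ->
  (exists L : R, L.-lipschitz_D (grad (authalic_energy S it bd))) ->
  pcg_iteration (grad (authalic_energy S it bd)) M alpha x p ->
  0 < c1 -> c1 < c2 -> c2 < 2^-1 ->
  strong_wolfe (authalic_energy S it bd) c1 c2 alpha x p ->
  limn_einf (fun k => (wnorm (invmx M) (grad (authalic_energy S it bd) (x k)))%:E)
    = 0%E.
Proof.
move=> _ _ _ Munit PW DA Dx [L lip] iter c1_gt0 c12 c2_lt wolfe.
apply: limn_einf_eq0 => [k|e m e0]; first exact: sqrtr_ge0.
have lip_iter k : `|grad (authalic_energy S it bd) (x k.+1) -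
    grad (authalic_energy S it bd) (x k)| <= L * `|x k.+1 - x k|.
  exact: (lip (x k.+1, x k) (conj (Dx _) (Dx _))).
have E_ge k := authalic_energy_ge S it bd (DA _ (Dx k)).
(* The weighted norm is the square root of the form, hence the threshold [e ^+ 2]. *)
have [k mk small] := pcg_gradient_small Munit PW iter c1_gt0 c12 c2_lt wolfe
  lip_iter E_ge m (exprn_gt0 2 e0).
exists k => //; rewrite /wnorm -(gtr0_norm e0) -sqrtr_sqr ltr_sqrt//.
exact: exprn_gt0.
Qed.
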